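(* Let $A\in\mathbb{R}^{m\times n}$ have rows $A_1,\dots,A_m$ with $\|A_i\|_2=1$ for all $i$, and let $P=\{x\in\mathbb{R}^n \mid Ax>\mathbf{0}\}$. Suppose $\lambda\in \mathbb{R}^m_{\ge 0}$, $\|\lambda\|_1=1$ and $\|\lambda A\|_2\le \frac{1}{10n}$. Let $M=\sum_{i=1}^m\lambda_iA_iA_i^T$ and suppose $0\le \alpha\le \frac{1}{\delta_{\max}}$, where $\delta_{\max}=\|M\|_{\mathrm{op}}$ denotes the maximal eigenvalue of $M$. Define $F(x)=(I+\alpha M)^{1/2}x$. Then $$\mathrm{vol}(F(P)\cap B)\ge e^{\alpha/5}\,\mathrm{vol}(P\cap B).$$
   Context: $B=\{x\in\mathbb{R}^n \mid \|x\|_2\le 1\}$ is the Euclidean unit ball. The rows $A_i$ are regarded as column vectors in the expression $A_iA_i^T$ (an $n\times n$ matrix), $\lambda A=\sum_{i=1}^m\lambda_iA_i$, and $Ax>\mathbf{0}$ is meant coordinatewise. *)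

(* Defs.v *)
From HB Require Import structures.
From mathcomp Require Import all_boot all_order all_algebra.
From mathcomp Require Import all_classical all_reals all_analysis.
From mathcomp Require Import ring lra.

Set Implicit Arguments.
Unset Strict Implicit.
Unset Printing Implicit Defensive.

Import Order.TTheory GRing.Theory Num.Theory.
Import numFieldNormedType.Exports.

Local Open Scope classical_set_scope.
Local Open Scope ring_scope.

Section Defs.
Context {R : realType}.

(* The norm carried by matrices in the library is the sup norm. *)
Definition l1norm n (x : 'cV[R]_n) : R := \sum_i `|x i 0|.
Definition l2norm n (x : 'cV[R]_n) : R := Num.sqrt (\sum_i x i 0 ^+ 2).

Definition unit_ball n : set 'cV[R]_n := [set x | l2norm x <= 1].

Definition row_vec m n (A : 'M[R]_(m, n)) (i : 'I_m) : 'cV[R]_n := (row i A)^T.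

Definition op_norm n (M : 'M[R]_n) : R :=
  sup [set l2norm (M *m x) | x in @unit_ball n].

(* [eigenvalue] is about left (row) eigenvectors; the eigenvalues are the same
   as for column vectors. *)
Definition max_eigenvalue n (M : 'M[R]_n) : R := sup [set a | eigenvalue M a].

Definition psdmx n (S : 'M[R]_n) : Prop :=
  S^T = S /\ forall x : 'cV[R]_n, 0 <= (x^T *m S *m x) 0 0.

Lemma l2norm_ge0 n (x : 'cV[R]_n) : 0 <= l2norm x.
Proof. exact: sqrtr_ge0. Qed.

Lemma sqr_l2norm n (x : 'cV[R]_n) : l2norm x ^+ 2 = (x^T *m x) 0 0.
Proof.
rewrite sqr_sqrtr ?sumr_ge0 // => [|i _]; last exact: sqr_ge0.
by rewrite mxE; apply: eq_bigr => i _; rewrite mxE expr2.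
Qed.

Lemma l2norm_eq0 n (x : 'cV[R]_n) : (l2norm x == 0) = (x == 0).
Proof.
apply/idP/eqP => [|->]; last by rewrite /l2norm big1 ?sqrtr0 // => i _; rewrite mxE expr0n.
rewrite -sqrf_eq0 sqr_sqrtr ?sumr_ge0 // => [|i _]; last exact: sqr_ge0.
rewrite psumr_eq0 => [/allP h|i _]; last exact: sqr_ge0.
apply/colP => i; rewrite mxE; apply/eqP; rewrite -sqrf_eq0.
exact: (h i (mem_index_enum i)).
Qed.

Lemma l2normZ n (a : R) (x : 'cV[R]_n) : l2norm (a *: x) = `|a| * l2norm x.
Proof.
rewrite /l2norm -sqrtr_sqr -sqrtrM ?sqr_ge0 // mulr_sumr.
by congr Num.sqrt; apply: eq_bigr => i _; rewrite mxE exprMn.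
Qed.

Lemma unit_ball_max n (M : 'M[R]_n) : exists2 x, unit_ball x &
  forall y, unit_ball y -> l2norm (M *m y) <= l2norm (M *m x).
Proof.
pose A : set 'rV[R]_n := [set r | \sum_i r 0 i ^+ 2 <= 1].
have ballE (r : 'rV[R]_n) : unit_ball r^T <-> A r.
  rewrite /unit_ball/= /l2norm; under eq_bigr do rewrite mxE.
  have s0 : 0 <= \sum_i r 0 i ^+ 2 by apply: sumr_ge0 => i _; exact: sqr_ge0.
  by rewrite -[X in _ <= X]sqrtr1 ler_sqrt.
have csum (g : 'I_n -> 'rV[R]_n -> R) : (forall i, continuous (g i)) ->
    continuous (fun r => \sum_i g i r ^+ 2).
  move=> cg; apply: continuous_big; [exact: add_continuous|move=> i _].
  by under eq_fun do rewrite expr2; move=> r; apply: continuousM; exact: cg.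
have cA : compact A.
  apply: bounded_closed_compact; last first.
    rewrite /A -[X in closed X]/((fun r : 'rV[R]_n => \sum_i r 0 i ^+ 2) @^-1` [set t | t <= 1]).
    apply: preimage_closed; last exact: closed_le.
    by move=> r _; apply: csum => i s; exact: coord_continuous.
  exists 1; split; first exact: num_real.
  move=> t t1 r Ar /=; rewrite [leLHS]/Num.Def.normr /= mx_normrE.
  apply: bigmax_le => [|[i j] _ /=]; first exact: ltW (lt_trans ltr01 t1).
  rewrite ord1.
  apply: (le_trans _ (ltW t1)).
  rewrite -(@ler_pXn2r _ 2) ?nnegrE ?normr_ge0// expr1n real_normK ?num_real//.
  apply: le_trans Ar; rewrite (bigD1 j)//= lerDl.
  by apply: sumr_ge0 => k _; exact: sqr_ge0.
have A0 : A !=set0.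
  by exists 0; rewrite /A /= big1 // => i _; rewrite mxE expr0n.
have cf : {within A, continuous (fun r : 'rV[R]_n => \sum_i (M *m r^T) i 0 ^+ 2)}.
  apply: continuous_subspaceT; apply: csum => i.
  under eq_fun do rewrite mxE.
  apply: continuous_big; [exact: add_continuous|move=> j _].
  under eq_fun do rewrite mxE.
  by move=> r; apply: continuousM; [exact: cst_continuous|exact: coord_continuous].
have [c Ac hc] := compact_EVT_max A0 cA cf.
exists c^T; first by apply/ballE; rewrite inE in Ac.
move=> y; rewrite -[y]trmxK => /ballE Ay.
by rewrite ler_wsqrtr//; apply: hc; rewrite inE.
Qed.

Lemma op_norm_max_eigenvalue n (M : 'M[R]_n) :
  psdmx M -> op_norm M = max_eigenvalue M.
Proof.
move=> [Msym Mpsd].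
have [x Bx hx] := unit_ball_max M.
set L := l2norm (M *m x) in hx.
have opE : op_norm M = L.
  apply/eqP; rewrite eq_le; apply/andP; split.
    by apply: ge_sup => [|_ [y By <-]]; [exists L, x|exact: hx].
  by apply: ub_le_sup; [exists L => _ [y By <-]; exact: hx|exists x].
have lipM y : l2norm (M *m y) <= L * l2norm y.
  have [->|y0] := eqVneq y 0.
    by rewrite mulmx0 -[X in l2norm X](scale0r (0 : 'cV[R]_n)) l2normZ normr0 !mul0r mulr_ge0 ?l2norm_ge0.
  have ny : 0 < l2norm y by rewrite lt_def l2norm_eq0 y0 l2norm_ge0.
  have := hx ((l2norm y)^-1 *: y).
  rewrite -scalemxAr l2normZ gtr0_norm ?invr_gt0// ler_pdivrMl// mulrC; apply.
  by rewrite /unit_ball /= l2normZ gtr0_norm ?invr_gt0// mulVf// gt_eqF.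
rewrite opE /max_eigenvalue; apply/eqP; rewrite eq_le; apply/andP; split; last first.
  have [->|/set0P E0] := eqVneq [set a | eigenvalue M a] set0.
    by rewrite sup0 l2norm_ge0.
  apply: ge_sup => // a /eigenvalueP[v va v0].
  have Mv : M *m v^T = a *: v^T by rewrite -[M]Msym -trmx_mul va linearZ.
  have := lipM v^T; rewrite Mv l2normZ ler_pM2r; last first.
    by rewrite lt_def l2norm_eq0 trmx_eq0 v0 l2norm_ge0.
  exact/le_trans/ler_norm.
have ubE : has_ubound [set a | eigenvalue M a].
  exists L => a /eigenvalueP[v va v0].
  have Mv : M *m v^T = a *: v^T by rewrite -[M]Msym -trmx_mul va linearZ.
  have := lipM v^T; rewrite Mv l2normZ ler_pM2r; last first.
    by rewrite lt_def l2norm_eq0 trmx_eq0 v0 l2norm_ge0.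
  exact/le_trans/ler_norm.
have [L0|L0] := eqVneq L 0.
  rewrite L0; have [->|/set0P E0] := eqVneq [set a | eigenvalue M a] set0.
    by rewrite sup0.
  have [a Ea] := E0; apply: le_trans (ub_le_sup ubE Ea).
  have /eigenvalueP[v va v0] := Ea.
  have := Mpsd v^T; rewrite trmxK va -scalemxAl mxE.
  have -> : (v *m v^T) 0 0 = l2norm v^T ^+ 2 by rewrite sqr_l2norm trmxK.
  rewrite pmulr_lge0 // exprn_gt0 //.
  by rewrite lt_def l2norm_eq0 trmx_eq0 v0 l2norm_ge0.
have Lp : 0 < L by rewrite lt_def L0 l2norm_ge0.
have x0 : x != 0.
  apply: contra_neq L0 => x0; rewrite /L x0 mulmx0.
  by apply/eqP; rewrite l2norm_eq0.
apply: ub_le_sup => //=.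
have MM : M *m (M *m x) = L ^+ 2 *: x.
  apply/eqP; rewrite -subr_eq0 -l2norm_eq0 -sqrf_eq0 eq_le sqr_ge0 andbT.
  have cross : x^T *m (M *m (M *m x)) = (M *m x)^T *m (M *m x).
    by rewrite trmx_mul Msym !mulmxA.
  have cross' : (M *m (M *m x))^T *m x = (M *m x)^T *m (M *m x).
    by rewrite trmx_mul Msym !mulmxA.
  rewrite sqr_l2norm.
  set y := M *m (M *m x) in cross cross' *.
  have -> : (y - L ^+ 2 *: x)^T *m (y - L ^+ 2 *: x) = y^T *m y - L ^+ 2 *: (y^T *m x)
      - (L ^+ 2 *: (x^T *m y) - L ^+ 2 *: (L ^+ 2 *: (x^T *m x))).
    have -> : (y - L ^+ 2 *: x)^T = y^T - L ^+ 2 *: x^T by apply/matrixP => i j; rewrite !mxE.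
    by rewrite mulmxBl !mulmxBr -!scalemxAr -!scalemxAl.
  rewrite cross cross'.
  have := sqr_l2norm x; have := sqr_l2norm (M *m x); have := sqr_l2norm y.
  move: (y^T *m y) (_^T *m (M *m x)) (x^T *m x) => p1 p2 p3 e1 e2 e3.
  rewrite !mxE -e1 -e2 -e3 -/L /y.
  have h2 : l2norm (M *m (M *m x)) ^+ 2 <= (L * L) ^+ 2.
    by rewrite ler_pXn2r ?nnegrE ?l2norm_ge0 ?mulr_ge0 ?(ltW Lp)//; exact: lipM.
  have h3 : l2norm x ^+ 2 <= 1 by rewrite expr_le1 ?l2norm_ge0.
  have h4 : 0 <= L ^+ 2 by exact: sqr_ge0.
  have h5 : (L ^+ 2) * (L ^+ 2 * l2norm x ^+ 2) <= L ^+ 2 * L ^+ 2.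
    by apply: ler_wpM2l => //; rewrite ler_piMr.
  nra.
apply/eigenvalueP; exists (M *m x + L *: x)^T.
  rewrite -[M in _ *m M]Msym -trmx_mul mulmxDr MM -scalemxAr addrC.
  by apply/matrixP => i j; rewrite ![_^T _ _]mxE [RHS]mxE [_^T _ _]mxE expr2 -scalerA -scalerDr mxE.
rewrite trmx_eq0; apply/eqP => h0.
have := congr1 (fun y => (x^T *m y) 0 0) h0.
rewrite mulmx0 mulmxDr mulmxA -scalemxAr [LHS]mxE [X in _ + X]mxE -sqr_l2norm [RHS]mxE.
apply/eqP; rewrite gt_eqF// ltr_wpDl//.
by rewrite mulr_gt0// exprn_gt0// lt_def l2norm_eq0 x0 l2norm_ge0.
Qed.

(* The principal square root N^(1/2) of a positive semidefinite matrix N: its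
   unique positive semidefinite square root (0 if N has none). *)
Definition sqrtmx n (N : 'M[R]_n) : 'M[R]_n :=
  xget 0 [set S | psdmx S /\ S *m S = N].

Definition box n (a b : 'cV[R]_n) : set 'cV[R]_n :=
  [set x | forall i, a i 0 <= x i 0 <= b i 0].

Definition box_volume n (a b : 'cV[R]_n) : R := \prod_i (b i 0 - a i 0).

(* Lebesgue outer measure on R^n, i.e. n-dimensional Lebesgue measure on all
   measurable sets: the infimum of the total volume of a countable cover by
   boxes.  The predicate K selects the boxes that are used, so that finite and
   empty covers are allowed. *)
Definition vol n (S : set 'cV[R]_n) : \bar R :=
  ereal_inf [set r | exists (K : pred nat) (a b : nat -> 'cV[R]_n),
    [/\ forall k i, a k i 0 <= b k i 0,
        S `<=` \bigcup_(k in [set k | K k]) box (a k) (b k) &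
        r = (\sum_(0 <= k <oo | K k) (box_volume (a k) (b k))%:E)%E]].

End Defs.

(* Main.v *)
(* Write N = I + alpha M and c = 1 + alpha / (10 n).  On the cone P one has
   0 < <A_i, x> <= |x|, so x^T M x <= <lambda A, x> |x| <= |x|^2 / (10 n) and
   F maps c^(-1/2) (P /\ B) into F(P) /\ B.  The volume is thus multiplied by at
   least c^(-n/2) det(N)^(1/2).  The eigenvalues of alpha M lie in [0, 1] and add
   up to alpha, so 1 + t >= e^(t/2) on [0, 1] gives det N >= e^(alpha/2), whereas
   c^n <= e^(alpha/10). *)
Require Import Defs.
From mathcomp Require Import all_boot all_order all_algebra.
From mathcomp Require Import all_classical all_reals all_analysis.
From mathcomp Require Import perm ring lra.
Import Order.TTheory GRing.Theory Num.Theory.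
Import numFieldNormedType.Exports.
Local Open Scope classical_set_scope.
Local Open Scope ring_scope.

Set Implicit Arguments.
Unset Strict Implicit.
Unset Printing Implicit Defensive.

(** * Lebesgue outer measure under countable unions and invertible linear maps *)

Section volume.
Context {R : realType} {n : nat}.
Implicit Types (a b x v : 'cV[R]_n) (S T : set 'cV[R]_n).

Lemma box_volume_ge0 a b : (forall i, a i 0 <= b i 0) -> 0 <= box_volume a b.
Proof. by move=> ab; apply: prodr_ge0 => i _; rewrite subr_ge0. Qed.

Lemma vol_ge0 S : (0 <= vol S)%E.
Proof.
apply: le_ereal_inf_tmp => _ [K [a [b [ab _ ->]]]].
by apply: nneseries_ge0 => k _ _; rewrite lee_fin box_volume_ge0.
Qed.

Lemma vol_subset S T : S `<=` T -> (vol S <= vol T)%E.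
Proof.
move=> ST; apply: ereal_inf_le_tmp => _ [K [a [b [ab Tab ->]]]].
by exists K, a, b; split => //; exact: subset_trans ST Tab.
Qed.

(** A cover indexed by a countable type is renumbered through [pickle]; the predicate [K] discards
    the codes that decode to nothing or to an index outside [D]. *)
Lemma vol_le_esum (I : countType) (D : set I) (a b : I -> 'cV[R]_n) S :
  (forall k i, a k i 0 <= b k i 0) ->
  S `<=` \bigcup_(k in D) box (a k) (b k) ->
  (vol S <= \esum_(k in D) (box_volume (a k) (b k))%:E)%E.
Proof.
move=> ab Sab; apply: ereal_inf_lbound.
pose c (f : I -> 'cV[R]_n) k := if @pickle_inv I k is Some i then f i else 0.
pose K k := if @pickle_inv I k is Some i then `[< D i >] else false.
have cab k i : c a k i 0 <= c b k i 0 by rewrite /c; case: pickle_inv.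
exists K, (c a), (c b); split => // [x /Sab[k Dk xk]|].
  exists (pickle k); rewrite /c/= /K pickleK_inv //; exact/asboolP.
rewrite nneseries_esum; last by move=> k _; rewrite lee_fin box_volume_ge0.
rewrite (@reindex_esum _ _ _ D [set k | K k] pickle).
  by apply: eq_esum => k _; rewrite /c pickleK_inv.
split.
- by move=> k Dk; rewrite /= /K pickleK_inv; exact/asboolP.
- by move=> j k _ _; exact: (pcan_inj pickleK_inv).
- move=> k; rewrite /= /K; case E: pickle_inv => [i|//] /asboolP Di.
  exists i => //; have := @pickle_invK I k; by rewrite E.
Qed.

(** Countable subadditivity: each [S k] gets a cover with excess at most [e / 2 ^ k.+1], and these
    covers merge into one indexed by pairs. *)
Lemma vol_bigcup_le (K : pred nat) (S : nat -> set 'cV[R]_n) (r : nat -> R) :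
  (forall k, 0 <= r k) -> (forall k, (vol (S k) <= (r k)%:E)%E) ->
  (vol (\bigcup_(k in [set k | K k]) S k) <= \sum_(0 <= k <oo | K k) (r k)%:E)%E.
Proof.
move=> r0 Sr; apply/lee_addgt0Pr => e e0.
have /choice[c cP] : forall k, exists c : pred nat * (nat -> 'cV[R]_n) * (nat -> 'cV[R]_n),
    [/\ forall j i, c.1.2 j i 0 <= c.2 j i 0,
        S k `<=` \bigcup_(j in [set j | c.1.1 j]) box (c.1.2 j) (c.2 j) &
        (\esum_(j in [set j | c.1.1 j]) (box_volume (c.1.2 j) (c.2 j))%:E
          <= (r k)%:E + (e / (2 ^ k.+1)%:R)%:E)%E].
  move=> k; have : (vol (S k) < (r k)%:E + (e / (2 ^ k.+1)%:R)%:E)%E.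
    apply: le_lt_trans (Sr k) _.
    by rewrite -EFinD lte_fin ltrDl divr_gt0// ltr0n expn_gt0.
  move=> /ereal_inf_lt[_ [J [a [b [ab Sab ->]]]] /ltW lt].
  exists (J, a, b); split => //=.
  by rewrite -nneseries_esum// => j _; rewrite lee_fin box_volume_ge0.
pose J k := (c k).1.1; pose a k := (c k).1.2; pose b k := (c k).2.
have ab k j i : a k j i 0 <= b k j i 0 by case: (cP k) => + _ _; exact.
have Sab k : S k `<=` \bigcup_(j in [set j | J k j]) box (a k j) (b k j).
  by case: (cP k) => _ + _; exact.
have Jr k : (\esum_(j in [set j | J k j]) (box_volume (a k j) (b k j))%:E
    <= (r k)%:E + (e / (2 ^ k.+1)%:R)%:E)%E by case: (cP k) => _ _; exact.
pose D := [set k | K k] `*`` (fun k => [set j | J k j]).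
apply: (@le_trans _ _
    (\esum_(p in D) (box_volume (a p.1 p.2) (b p.1 p.2))%:E)%E).
  apply: vol_le_esum => [[k j] i|x [k Kk /Sab[j Jj xj]]]; first exact: ab.
  by exists (k, j).
rewrite -(esum_esum (a := fun k j => (box_volume (a k j) (b k j))%:E)); last first.
  by move=> k j _ _; rewrite lee_fin box_volume_ge0.
apply: (@le_trans _ _ (\esum_(k in [set k | K k]) ((r k)%:E + (e / (2 ^ k.+1)%:R)%:E))%E).
  by apply: le_esum => k _; exact: Jr.
rewrite -nneseries_esum.
  by apply: epsilon_trick => [k|]; rewrite ?lee_fin// ltW.
move=> k _; rewrite -EFinD lee_fin addr_ge0// divr_ge0//; exact: ltW.
Qed.

Lemma vol_le_sum N (a b : nat -> 'cV[R]_n) S :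
  (forall k i, a k i 0 <= b k i 0) ->
  S `<=` \bigcup_(k in `I_N) box (a k) (b k) ->
  (vol S <= (\sum_(k < N) box_volume (a k) (b k))%:E)%E.
Proof.
move=> ab Sab; apply: le_trans (vol_le_esum ab Sab) _.
rewrite esum_fset//; last by move=> k _; rewrite lee_fin box_volume_ge0.
by rewrite -fsbig_ord sumEFin.
Qed.

(** Only the upper bound is stated, for arbitrary sets; for invertible [G] the lower bound comes
    from the same property of the inverse matrix. *)
Definition vol_image_le (G : 'M[R]_n) : Prop :=
  forall T, (vol ((fun x => G *m x)%R @` T) <= `|\det G|%:E * vol T)%E.

(** The images of the boxes of a cover of [T] cover the image of [T], and subadditivity sums their
    bounds. Invertibility allows dividing by the determinant before passing to the infimum over
    covers. *)
Lemma vol_image_le_box (G : 'M[R]_n) : G \in unitmx ->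
  (forall a b, (forall i, a i 0 <= b i 0) ->
    (vol ((fun x => G *m x)%R @` box a b) <= (`|\det G| * box_volume a b)%:E)%E) ->
  vol_image_le G.
Proof.
rewrite unitmxE unitfE -normr_gt0 => G0 Gbox T.
rewrite -lee_pdivrMl//; apply: le_ereal_inf_tmp => _ [K [a [b [ab Tab ->]]]].
rewrite lee_pdivrMl// -nneseriesZl; last by move=> k _; rewrite lee_fin box_volume_ge0.
apply: le_trans (@vol_bigcup_le K (fun k => (fun x => G *m x) @` box (a k) (b k))
  (fun k => `|\det G| * box_volume (a k) (b k)) _ _).
- by apply: vol_subset => _ [x /Tab[k Kk xk] <-]; exists k => //; exists x.
- by move=> k; rewrite mulr_ge0// box_volume_ge0.
- by move=> k; exact: Gbox.
Qed.

Lemma vol_image_le_mul (G H : 'M[R]_n) :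
  vol_image_le G -> vol_image_le H -> vol_image_le (G *m H).
Proof.
move=> cG cH T; rewrite det_mulmx normrM EFinM -muleA.
have -> : (fun x => G *m H *m x)%R @` T = (fun x => G *m x) @` ((fun x => H *m x)%R @` T).
  by rewrite image_comp; congr image; apply/funext => x; rewrite /= mulmxA.
by apply: le_trans (cG _) _; rewrite lee_wpmul2l// ?lee_fin.
Qed.

Lemma vol_image_le1 : vol_image_le 1%:M.
Proof.
move=> T; rewrite det1 normr1 mul1e; apply: vol_subset.
by move=> _ [x Tx <-]; rewrite mul1mx.
Qed.

Lemma vol_image_le_tperm i j : vol_image_le (tperm_mx i j).
Proof.
apply: vol_image_le_box; first by rewrite unitmx_perm.
move=> a b ab; rewrite det_perm normr_sign mul1r.
have E (x : 'cV[R]_n) k : (tperm_mx i j *m x) k 0 = x (tperm i j k) 0.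
  by rewrite -row_permE mxE.
have -> : box_volume a b = box_volume (tperm_mx i j *m a) (tperm_mx i j *m b).
  rewrite /box_volume (reindex_inj (@perm_inj _ (tperm i j))).
  by apply: eq_bigr => k _; rewrite !E.
have := @vol_le_sum 1 (fun=> tperm_mx i j *m a) (fun=> tperm_mx i j *m b)
  ((fun x => tperm_mx i j *m x)%R @` box a b).
rewrite big_ord1; apply => [k l|_ [x xab <-]]; first by rewrite !E.
by exists 0%N => // k; rewrite !E.
Qed.

(** One whole pivot step of elimination in a single matrix: coordinate [k] is scaled and multiples
    of it are added to all the others. *)
Definition set_col k v : 'M[R]_n :=
  \matrix_(i, j) if j == k then v i 0 else (i == j)%:R.

Lemma set_colE k v x i : (set_col k v *m x) i 0 = (if i == k then 0 else x i 0) + v i 0 * x k 0.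
Proof.
rewrite mxE (bigD1 k)//= mxE eqxx addrC; congr (_ + _).
have [->|ik] := eqVneq i k.
  by rewrite big1// => j jk; rewrite mxE (negPf jk) eq_sym (negPf jk) mul0r.
rewrite (bigD1 i)//= mxE (negPf ik) eqxx mul1r big1 ?addr0// => j /andP[jk ji].
by rewrite mxE (negPf jk) eq_sym (negPf ji) mul0r.
Qed.

Lemma det_set_col k v : \det (set_col k v) = v k 0.
Proof.
rewrite (expand_det_row _ k) (bigD1 k)//= big1 ?addr0 => [|j jk]; last first.
  by rewrite mxE (negPf jk) eq_sym (negPf jk) mul0r.
rewrite mxE eqxx /cofactor addnn -signr_odd odd_double expr0 mul1r.
suff -> : row' k (col' k (set_col k v)) = 1%:M by rewrite det1 mulr1.
apply/matrixP => i j; rewrite !mxE eq_sym (negPf (neq_lift k j)).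
by rewrite (inj_eq lift_inj).
Qed.

Lemma ex_subinterval (N : nat) (c h x : R) : c <= x <= c + N.+1%:R * h ->
  exists2 k : nat, (k < N.+1)%N & c + k%:R * h <= x <= c + k.+1%:R * h.
Proof.
move=> /andP[cx xN].
have ex : exists k : nat, x <= c + k.+1%:R * h by exists N.
exists (ex_minn ex); case: ex_minnP => k xk mink; first by rewrite ltnS mink.
rewrite xk andbT; case: k xk mink => [_ _|k xk mink]; first by rewrite mul0r addr0.
by rewrite leNgt; apply/negP => /ltW /mink; rewrite ltnn.
Qed.

(* The box is cut along coordinate [k] into [N + 1] slices of width [h]; the image
   of a slice lies in a box whose sides grew by at most [`|v i 0| * h]. *)
Lemma vol_set_col_slices k v a b N : (forall i, a i 0 <= b i 0) ->
  (vol ((fun x => set_col k v *m x)%R @` box a b) <=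
   (`|v k 0| * (b k 0 - a k 0) * \prod_(i | i != k)
     (b i 0 - a i 0 + `|v i 0| * (b k 0 - a k 0) * N.+1%:R^-1))%:E)%E.
Proof.
move=> ab; pose h := (b k 0 - a k 0) / N.+1%:R.
have h0 : 0 <= h by rewrite divr_ge0// subr_ge0.
have Nh : N.+1%:R * h = b k 0 - a k 0 by rewrite mulrC divfK.
(* [m j] is the midpoint of slice [j], so on that slice [v i 0 * x k 0] stays within
   [|v i 0| * h / 2] of [v i 0 * m j]. [off_k] drops coordinate [k], whose contribution is carried
   by [v] alone. *)
pose m (j : nat) := a k 0 + j%:R * h + h / 2.
pose off_k (x : 'cV[R]_n) i := if i == k then 0 else x i 0.
pose lo j : 'cV[R]_n := \col_i (off_k a i + v i 0 * m j - `|v i 0| * h / 2).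
pose hi j : 'cV[R]_n := \col_i (off_k b i + v i 0 * m j + `|v i 0| * h / 2).
have lohi j i : hi j i 0 - lo j i 0 = off_k b i - off_k a i + `|v i 0| * h.
  by rewrite !mxE; field.
have off_ab i : off_k a i <= off_k b i by rewrite /off_k; case: ifP.
apply: le_trans (vol_le_sum (N := N.+1) (a := lo) (b := hi) _ _) _.
- by move=> j i; rewrite -subr_ge0 lohi addr_ge0 ?subr_ge0// mulr_ge0.
- move=> _ [x xab <-].
  have /ex_subinterval[j jN /andP[jx xj]] : a k 0 <= x k 0 <= a k 0 + N.+1%:R * h.
    by rewrite Nh addrCA subrr addr0; exact: xab.
  exists j => // i; rewrite set_colE !mxE.
  have xm : `|v i 0 * (x k 0 - m j)| <= `|v i 0| * h / 2.
    rewrite normrM -mulrA ler_wpM2l// ler_norml /m.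
    by move: xj; rewrite -natr1 => xj; apply/andP; split; lra.
  have /andP[] : off_k a i <= off_k x i <= off_k b i.
    by rewrite /off_k; case: ifP => _; [rewrite lexx|exact: xab].
  move: xm; rewrite ler_norml mulrBr -/(off_k x i) => /andP[]; lra.
have volE j : box_volume (lo j) (hi j) =
    \prod_i (off_k b i - off_k a i + `|v i 0| * h).
  by apply: eq_bigr => i _; rewrite lohi.
rewrite lee_fin (eq_bigr _ (fun j _ => volE (nat_of_ord j))).
(* All [N.+1] boxes have the same volume; its factor at [k] is [|v k 0| * h], and [N.+1] copies of
   [h] restore the full side. *)
rewrite sumr_const card_ord (bigD1 k)//= /off_k eqxx subrr add0r.
rewrite -[leLHS]mulr_natl [leLHS]mulrA le_eqVlt; apply/orP; left; apply/eqP.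
congr (_ * _); first by rewrite -Nh mulrCA.
by apply: eq_bigr => i /negPf ->; rewrite /h mulrA.
Qed.

(** The slice bound is a polynomial in [1 / (N + 1)]; as the slices get thinner it tends to its
    value at 0, the exact product. *)
Lemma vol_image_le_set_col k v : v k 0 != 0 -> vol_image_le (set_col k v).
Proof.
move=> vk0; apply: vol_image_le_box => [|a b ab].
  by rewrite unitmxE unitfE det_set_col.
rewrite det_set_col.
pose g (t : R) : R := `|v k 0| * (b k 0 - a k 0) * \prod_(i | i != k)
  (b i 0 - a i 0 + `|v i 0| * (b k 0 - a k 0) * t).
have cg : continuous g.
  move=> t; apply: cvgM; first exact: cvg_cst.
  apply: continuous_big t => [|i _ t]; first exact: mul_continuous.
  by apply: cvgD; [exact: cvg_cst|apply: cvgM; [exact: cvg_cst|exact: cvg_id]].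
have -> : `|v k 0| * box_volume a b = g 0.
  rewrite /g /box_volume (bigD1 k)//= mulrA; congr (_ * _).
  by apply: eq_bigr => i _; rewrite mulr0 addr0.
have cvg_g : g (harmonic N) @[N --> \oo] --> g 0.
  exact: continuous_cvg (cg 0) cvg_harmonic.
have volg N : (vol ((fun x => set_col k v *m x)%R @` box a b) <= (g (harmonic N))%:E)%E.
  exact: vol_set_col_slices.
move: (vol_ge0 ((fun x => set_col k v *m x)%R @` box a b)) volg.
case: (vol _) => [r _ rg|_ /(_ 0%N)//|//].
rewrite lee_fin -(cvg_lim _ cvg_g)//; apply: limr_ge; first by apply/cvg_ex; exists (g 0).
by near=> N; have := rg N; rewrite lee_fin.
Unshelve. all: by end_near.
Qed.

(* Gauss-Jordan elimination: the first [k] columns of [G] are already those of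
   the identity, and clearing the next one splits a [set_col] off [G]. *)
Lemma vol_image_le_unitmx_cols k (G : 'M[R]_n) : G \in unitmx -> (k <= n)%N ->
  (forall i j : 'I_n, (j < n - k)%N -> G i j = (i == j)%:R) -> vol_image_le G.
Proof.
elim: k G => [|k IH] G Gu kn Gcol.
  suff -> : G = 1%:M by exact: vol_image_le1.
  by apply/matrixP => i j; rewrite Gcol ?subn0// mxE.
(* With [k.+1] columns left to clear, the next one has index [n - k.+1]. *)
have ltcn : (n - k.+1 < n)%N by rewrite ltn_subrL (leq_ltn_trans _ kn).
pose c := Ordinal ltcn.
have [p cp Gp] : exists2 p : 'I_n, (c <= p)%N & G p c != 0.
  apply: contrapT => noP.
  have Gc (p : 'I_n) : (c <= p)%N -> G p c = 0.
    by move=> cp; apply/eqP/negPn/negP => Gp; apply: noP; exists p.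
  (* Without a pivot, column [c] would be a combination of the earlier columns, which are those of
     the identity; [z] is the resulting nonzero kernel vector. *)
  pose z : 'cV[R]_n := \col_j (if j == c then 1 else if (j < c)%N then - G j c else 0).
  have Gz : G *m z = 0.
    apply/colP => i; rewrite !mxE (bigD1 c)//= mxE eqxx mulr1.
    have [ic|ci] := ltnP i c; last first.
      rewrite Gc// add0r big1// => j jc; rewrite mxE (negPf jc).
      case: ifP => [jc'|_]; last by rewrite mulr0.
      by rewrite Gcol// -val_eqE/= gtn_eqF ?mul0r// (leq_trans jc').
    rewrite (bigD1 i)/=; last by rewrite -val_eqE/= ltn_eqF.
    rewrite mxE -val_eqE/= ltn_eqF// ic (Gcol i i)// eqxx mul1r big1 ?addr0 ?subrr//.
    move=> j /andP[jc ji]; rewrite mxE (negPf jc).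
    case: ifP => [jc'|_]; last by rewrite mulr0.
    by rewrite Gcol// eq_sym (negPf ji) mul0r.
  have : z c 0 = 0 by rewrite -[z](mulKmx Gu) Gz mulmx0 mxE.
  by rewrite mxE eqxx => /eqP; rewrite oner_eq0.
pose H := tperm_mx c p *m G.
have HE i j : H i j = G (tperm c p i) j by rewrite /H -row_permE mxE.
have Hcol i (j : 'I_n) : (j < c)%N -> H i j = (i == j)%:R.
  move=> jc; rewrite HE Gcol//; congr (_%:R); congr nat_of_bool.
  case: tpermP => [->|->|//]; rewrite -!val_eqE/=.
    by rewrite !gtn_eqF// (leq_trans jc).
  by rewrite !gtn_eqF// (leq_trans jc).
have Hc0 : H c c != 0 by rewrite HE tpermL.
(* [set_col c w] inverts [set_col c (col c H)]: it turns column [c] of [H] into a basis vector and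
   keeps the earlier columns. *)
pose w : 'cV[R]_n := \col_i (if i == c then (H c c)^-1 else - H i c / H c c).
have wc0 : w c 0 != 0 by rewrite mxE eqxx invr_eq0.
pose G' := set_col c w *m H.
have G'E i j : G' i j = (if i == c then 0 else H i j) + w i 0 * H c j.
  by have := set_colE c w (col j H) i; rewrite colE mulmxA -!colE !mxE.
have HG' : H = set_col c (col c H) *m G'.
  apply/matrixP => i j; have := set_colE c (col c H) (col j G') i.
  rewrite [col j G']colE mulmxA -!colE ![col _ _ _ _]mxE => ->.
  rewrite !G'E eqxx add0r [w c 0]mxE [w i 0]mxE eqxx.
  have [->|ic] := eqVneq i c; first by rewrite add0r mulrA divff// mul1r.
  by field.
have -> : G = tperm_mx c p *m (set_col c (col c H) *m G').
  by rewrite -HG' /H mulmxA -perm_mxM tperm2 perm_mx1 mul1mx.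
apply: vol_image_le_mul; first exact: vol_image_le_tperm.
apply: vol_image_le_mul; first by apply: vol_image_le_set_col; rewrite mxE.
apply: IH => [||i j jk]; first 1 last.
- exact: ltnW.
- rewrite G'E; have [jc|jc] := eqVneq j c.
    rewrite jc [w i 0]mxE; case: eqP => _; first by rewrite add0r mulVf.
    by rewrite divfK// subrr.
  have jc' : (j < c)%N.
    by rewrite ltn_neqAle jc/= -ltnS -subSn.
  rewrite !Hcol// [c == j]eq_sym (negPf jc) mulr0 addr0.
  by case: eqP => // ->; rewrite eq_sym (negPf jc).
by rewrite !unitmx_mul unitmx_perm Gu unitmxE det_set_col unitfE wc0.
Qed.

Lemma vol_image_le_unitmx (G : 'M[R]_n) : G \in unitmx -> vol_image_le G.
Proof.
by move=> Gu; apply: (vol_image_le_unitmx_cols Gu (leqnn n)) => i j; rewrite subnn.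
Qed.

End volume.

(** * Spectral theorem for positive semidefinite matrices, square roots, determinant bound *)

Section spectral.
Context {R : realType}.

Lemma psdmx_mulmx_trmx m n (B : 'M[R]_(m, n)) : psdmx (B^T *m B).
Proof.
split=> [|x]; first by rewrite trmx_mul trmxK.
by rewrite mulmxA -trmx_mul -mulmxA -sqr_l2norm sqr_ge0.
Qed.

Lemma psdmx_congr m n (N : 'M[R]_n) (B : 'M[R]_(n, m)) :
  psdmx N -> psdmx (B^T *m N *m B).
Proof.
move=> [Nsym N0]; split=> [|x]; first by rewrite !trmx_mul trmxK Nsym mulmxA.
have := N0 (B *m x); by rewrite trmx_mul !mulmxA.
Qed.

(* Without eigenvalues, [op_norm N = max_eigenvalue N = sup set0 = 0], so [N = 0]. *)
Lemma psdmx_eigenvalue n (N : 'M[R]_n.+1) : psdmx N -> exists a, eigenvalue N a.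
Proof.
move=> psdN; apply: contrapT => noE.
have op0 : op_norm N = 0.
  rewrite op_norm_max_eigenvalue// /max_eigenvalue.
  rewrite (_ : [set a | _] = set0) ?sup0//.
  by rewrite -subset0 => a Ea; apply: noE; exists a.
(* With operator norm 0, [N] kills the first basis vector, which is thus an eigenvector for 0. *)
apply: noE; exists 0; apply/eigenvalueP; exists (delta_mx 0 0).
  rewrite scale0r; apply/rowP => j; rewrite -rowE [LHS]mxE [RHS]mxE.
  have [x Bx maxx] := unit_ball_max N.
  have Be : unit_ball (delta_mx 0 0 : 'cV[R]_n.+1).
    rewrite /unit_ball/= /l2norm (bigD1 0)//= mxE eqxx expr1n big1 ?addr0 ?sqrtr1//.
    by move=> i i0; rewrite mxE (negPf i0) expr0n.
  have : l2norm (N *m delta_mx 0 0) <= 0.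
    rewrite -op0; apply: ub_le_sup; last by exists (delta_mx 0 0).
    by exists (l2norm (N *m x)) => _ [y By <-]; exact: maxx.
  rewrite le_eqVlt ltNge l2norm_ge0 orbF l2norm_eq0 -colE => /eqP/colP/(_ j).
  by rewrite !mxE -{1}psdN.1 mxE.
apply/eqP => /rowP/(_ 0)/eqP; rewrite !mxE !eqxx; exact/negP/oner_neq0.
Qed.

(* Householder reflection exchanging [x] and the first basis vector *)
Lemma ex_orthogonal_col0 n (x : 'cV[R]_n.+1) : (x^T *m x) 0 0 = 1 ->
  exists2 H : 'M[R]_n.+1, H^T *m H = 1%:M & H *m delta_mx 0 0 = x.
Proof.
move=> x1; have [->|xe] := eqVneq x (delta_mx 0 0).
  by exists 1%:M; rewrite ?trmx1 mul1mx.
pose e : 'cV[R]_n.+1 := delta_mx 0 0; pose v := x - e.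
pose q := (v^T *m v) 0 0.
have q0 : q != 0 by rewrite /q -sqr_l2norm sqrf_eq0 l2norm_eq0 subr_eq0.
have sc (M : 'M[R]_1) : M = (M 0 0)%:M by rewrite [LHS]mx11_scalar.
have vvv : v^T *m v = q%:M by exact: sc.
pose H : 'M[R]_n.+1 := 1%:M - (2 / q) *: (v *m v^T).
have Hsym : H^T = H.
  by rewrite /H linearB/= trmx1 linearZ/= trmx_mul trmxK.
have WW : (v *m v^T) *m (v *m v^T) = q *: (v *m v^T).
  by rewrite mulmxA -(mulmxA v) vvv mul_mx_scalar -scalemxAl.
exists H.
  rewrite Hsym /H mulmxBl mul1mx mulmxBr mulmx1 -scalemxAl -scalemxAr WW !scalerA.
  rewrite (_ : 2 / q * (2 / q) * q = 2 / q + 2 / q); last by field.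
  by rewrite scalerDl opprB addrK subrK.
(* Since [x] and [e] are unit vectors, [q = 2 - 2 <x, e>], so [<v, e> = <x, e> - 1 = - q / 2] and
   the reflection sends [e] to [e + v = x]. *)
have ve : (v^T *m e) 0 0 = - q / 2.
  have ee : (e^T *m e) 0 0 = 1 by rewrite trmx_delta mul_delta_mx mxE !eqxx.
  have ex : (e^T *m x) 0 0 = (x^T *m e) 0 0.
    by rewrite -[in RHS](trmxK e) -trmx_mul [RHS]mxE.
  have vE : v^T = x^T - e^T by rewrite /v linearB.
  rewrite /q vE mulmxBl mulmxBl /v 2!mulmxBr.
  move: ee ex x1; rewrite !mxE => -> -> ->; lra.
rewrite /H mulmxBl mul1mx -scalemxAl -mulmxA (sc (v^T *m _)) ve.
rewrite mul_mx_scalar scalerA (_ : 2 / q * _ = -1); last by field.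
by rewrite scaleN1r opprK addrCA subrr addr0.
Qed.

Definition orthogonally_diagonalizable n (N : 'M[R]_n) : Prop :=
  exists (Q : 'M[R]_n) (d : 'rV[R]_n), Q^T *m Q = 1%:M /\ N = Q *m diag_mx d *m Q^T.

(** Induction on the dimension: conjugating by an orthogonal matrix that sends the first basis
    vector to a unit eigenvector splits off a 1 x 1 block, and the remaining block is again positive
    semidefinite. *)
Lemma psdmx_diagonalizable n (N : 'M[R]_n) :
  psdmx N -> orthogonally_diagonalizable N.
Proof.
elim: n N => [|n IH] N psdN.
  by exists 1%:M, 0; split; [rewrite trmx1 mul1mx|apply/matrixP => -[]].
have [a /eigenvalueP[u uN u0]] := psdmx_eigenvalue psdN.
have lu : l2norm u^T != 0 by rewrite l2norm_eq0 trmx_eq0.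
pose x := (l2norm u^T)^-1 *: u^T.
have x1 : (x^T *m x) 0 0 = 1.
  rewrite -sqr_l2norm /x l2normZ ger0_norm ?invr_ge0 ?l2norm_ge0//.
  by rewrite mulVf// expr1n.
have Nx : N *m x = a *: x.
  by rewrite /x -scalemxAr -[N]psdN.1 -trmx_mul uN linearZ/= !scalerA mulrC.
have [H HH He] := ex_orthogonal_col0 x1.
have HH' : H *m H^T = 1%:M by exact: mulmx1C.
pose K : 'M[R]_n.+1 := H^T *m N *m H.
have psdK : psdmx K by exact: psdmx_congr.
have Kcol i : K i 0 = a * (i == 0)%:R.
  have <- : col 0 K i 0 = K i 0 by rewrite mxE.
  rewrite colE /K -!mulmxA He Nx -scalemxAr -He mulmxA HH mul1mx mxE.
  by rewrite mxE eqxx andbT.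
have Krow j : K 0 j = a * (j == 0)%:R by rewrite -Kcol -{1}psdK.1 mxE.
have NE : N = H *m K *m H^T.
  by rewrite /K !mulmxA HH' mul1mx -mulmxA HH' mulmx1.
clearbody K.
pose K' := drsubmx (K : 'M[R]_(1 + n)).
have KE : (K : 'M[R]_(1 + n)) = block_mx a%:M 0 0 K'.
  apply: etrans (esym (submxK (K : 'M[R]_(1 + n)))) _; congr block_mx.
  - by apply/matrixP => i j; rewrite !ord1 !mxE lshift0 Kcol mulr1.
  - by apply/matrixP => i j; rewrite ord1 !mxE lshift0 Krow -val_eqE/= mulr0.
  - by apply/matrixP => i j; rewrite ord1 !mxE lshift0 Kcol -val_eqE/= mulr0.
have psdK' : psdmx K'.
  (* [E] embeds the last [n] coordinates, which exhibits [K'] as a congruence of [K]. *)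
  pose E : 'M[R]_(1 + n, n) := col_mx 0 1%:M.
  have -> : K' = E^T *m (K : 'M[R]_(1 + n)) *m E.
    rewrite KE /E tr_col_mx trmx0 trmx1 mul_row_block !mul0mx !mul1mx !add0r.
    by rewrite mul_row_col mulmx0 add0r mulmx1.
  exact: psdmx_congr.
have [Q [d [QQ K'E]]] := IH _ psdK'.
pose Q1 : 'M[R]_(1 + n) := block_mx 1%:M 0 0 Q.
have QQ1 : Q1^T *m Q1 = 1%:M.
  rewrite /Q1 tr_block_mx mulmx_block !trmx0 trmx1 !mulmx0 !mul0mx mulmx1 QQ.
  by rewrite !addr0 add0r -scalar_mx_block.
pose d1 : 'rV[R]_(1 + n) := row_mx a%:M d.
have KE1 : (K : 'M[R]_(1 + n)) = Q1 *m diag_mx d1 *m Q1^T.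
  rewrite KE K'E /Q1 diag_mx_row tr_block_mx !mulmx_block.
  rewrite !trmx0 trmx1 !mulmx0 !mul0mx !mulmx1 !mul1mx !addr0 !add0r.
  by congr block_mx; rewrite ?mul0mx//; apply/matrixP => i j; rewrite !ord1 !mxE.
exists (H *m Q1), d1; split.
  by rewrite trmx_mul mulmxA -(mulmxA Q1^T) HH mulmx1.
by rewrite NE KE1 trmx_mul !mulmxA.
Qed.

Lemma psdmx_diag_ge0 n (Q : 'M[R]_n) (d : 'rV[R]_n) : Q^T *m Q = 1%:M ->
  psdmx (Q *m diag_mx d *m Q^T) -> forall i, 0 <= d 0 i.
Proof.
move=> QQ psdN i.
have := psdmx_congr Q psdN; rewrite !mulmxA QQ mul1mx -mulmxA QQ mulmx1.
by case=> _ /(_ (delta_mx i 0)); rewrite trmx_delta -rowE -colE !mxE eqxx.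
Qed.

Lemma eigenvalue_diagP n (Q : 'M[R]_n) (d : 'rV[R]_n) a : Q^T *m Q = 1%:M ->
  eigenvalue (Q *m diag_mx d *m Q^T) a <-> exists i, a = d 0 i.
Proof.
move=> QQ; have QQ' := mulmx1C QQ; split=> [/eigenvalueP[v va v0]|[i ->]].
  have vQ0 : v *m Q != 0.
    by apply: contra_neq v0 => vQ; rewrite -[v]mulmx1 -QQ' mulmxA vQ mul0mx.
  have [i vi] : exists i, (v *m Q) 0 i != 0 by apply/rV0Pn.
  exists i; apply: (mulIf vi).
  have : v *m Q *m diag_mx d = a *: (v *m Q).
    by rewrite scalemxAl -va !mulmxA -(mulmxA _ Q^T) QQ mulmx1.
  by move=> /rowP/(_ i); rewrite mul_mx_diag !mxE mulrC => ->.
apply/eigenvalueP; exists (row i Q^T).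
  rewrite -row_mul !mulmxA QQ mul1mx mul_diag_mx.
  by apply/rowP => j; rewrite !mxE.
apply/eqP => /(congr1 (mulmxr Q)); rewrite /= -row_mul QQ mul0mx.
by move=> /rowP/(_ i)/eqP; rewrite !mxE eqxx oner_eq0.
Qed.

(** [max_eigenvalue] is a supremum, so an upper bound has to be supplied: the sum of the nonnegative
    eigenvalues exceeds each of them. *)
Lemma psdmx_eigenvalue_le n (N : 'M[R]_n) a : psdmx N ->
  eigenvalue N a -> a <= max_eigenvalue N.
Proof.
move=> psdN; have [Q [d [QQ NE]]] := psdmx_diagonalizable psdN.
move=> Ea; apply: ub_le_sup => //; exists (\sum_i d 0 i) => b /=.
rewrite NE => /(eigenvalue_diagP _ _ QQ)[i ->].
rewrite (bigD1 i)//= lerDl sumr_ge0// => j _.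
by apply: (psdmx_diag_ge0 QQ); rewrite -NE.
Qed.

(** [xget] returns a member of its set once one exists; the witness takes square roots of the
    eigenvalues. *)
Lemma sqrtmxP n (N : 'M[R]_n) : psdmx N ->
  psdmx (sqrtmx N) /\ sqrtmx N *m sqrtmx N = N.
Proof.
move=> psdN; apply: (@xgetPex _ 0 [set S | psdmx S /\ S *m S = N]).
have [Q [d [QQ NE]]] := psdmx_diagonalizable psdN.
have d0 : forall i, 0 <= d 0 i by apply: (psdmx_diag_ge0 QQ); rewrite -NE.
pose D (f : R -> R) := diag_mx (map_mx f d).
exists (Q *m D Num.sqrt *m Q^T); split.
  (* Fourth roots of the eigenvalues write the middle factor as [B^T *m B], hence positive
     semidefinite. *)
  rewrite (_ : D _ = (D (Num.sqrt \o Num.sqrt))^T *m D (Num.sqrt \o Num.sqrt)).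
    by have := psdmx_congr Q^T (psdmx_mulmx_trmx (D (Num.sqrt \o Num.sqrt))); rewrite trmxK.
  rewrite tr_diag_mx mulmx_diag; congr diag_mx; apply/rowP => i.
  by rewrite !mxE -expr2 sqr_sqrtr// sqrtr_ge0.
rewrite NE !mulmxA -(mulmxA _ Q^T) QQ mulmx1 -(mulmxA Q) mulmx_diag.
congr (_ *m diag_mx _ *m _); apply/rowP => i.
by rewrite !mxE -expr2 sqr_sqrtr.
Qed.

(** From [exp(-x/2) >= 1 - x/2] and [(1 - x/2)(1 + x) = 1 + x(1 - x)/2 >= 1]. *)
Lemma expR_half_le (x : R) : 0 <= x <= 1 -> expR (x / 2) <= 1 + x.
Proof.
move=> /andP[x0 x1]; have := expR_ge1Dx (- (x / 2)).
rewrite expRN; have := expR_gt0 (x / 2); set e := expR _ => e0 h.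
have : (1 - x / 2) * e <= 1 by rewrite -ler_pdivlMr// div1r.
have : 0 <= e * (x * (1 - x)) by rewrite mulr_ge0 ?mulr_ge0 ?subr_ge0// ltW.
nra.
Qed.

Lemma expR_mxtrace_le_det n (N : 'M[R]_n) : psdmx N ->
  (forall a, eigenvalue N a -> a <= 1) -> expR (\tr N / 2) <= \det (1%:M + N).
Proof.
move=> psdN; have [Q [d [QQ NE]]] := psdmx_diagonalizable psdN => N1.
have d0 : forall i, 0 <= d 0 i by apply: (psdmx_diag_ge0 QQ); rewrite -NE.
have d1 i : d 0 i <= 1 by apply: N1; rewrite NE; apply/(eigenvalue_diagP _ _ QQ); exists i.
have -> : 1%:M + N = Q *m diag_mx (const_mx 1 + d) *m Q^T.
  by rewrite linearD/= diag_const_mx mulmxDr mulmx1 mulmxDl (mulmx1C QQ) NE.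
rewrite [in \tr N]NE mxtrace_mulC mulmxA QQ mul1mx mxtrace_diag.
rewrite !det_mulmx mulrAC -det_mulmx (mulmx1C QQ) det1 mul1r det_diag.
rewrite mulr_suml expR_sum; apply: ler_prod => i _.
by rewrite expR_ge0 !mxE expR_half_le// d0 d1.
Qed.

(** Cauchy-Schwarz: with [u = |x|] and [v = |y|], expanding the square of [|v x - u y|] gives
    [2uv(uv - <x, y>) >= 0]; zero norms are treated first so that [uv] cancels. *)
Lemma dotmx_le_l2norm n (x y : 'cV[R]_n) : (x^T *m y) 0 0 <= l2norm x * l2norm y.
Proof.
have [x0|x0] := eqVneq (l2norm x) 0.
  move/eqP: (x0); rewrite l2norm_eq0 => /eqP ->.
  by rewrite trmx0 mul0mx mxE mulr_ge0 ?l2norm_ge0.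
have [y0|y0] := eqVneq (l2norm y) 0.
  move/eqP: (y0); rewrite l2norm_eq0 => /eqP ->.
  by rewrite mulmx0 mxE mulr_ge0 ?l2norm_ge0.
have xy0 : 0 < l2norm x * l2norm y.
  by rewrite mulr_gt0// lt_def ?x0 ?y0 l2norm_ge0.
have := sqr_ge0 (l2norm (l2norm y *: x - l2norm x *: y)).
rewrite sqr_l2norm.
have -> : (l2norm y *: x - l2norm x *: y)^T = l2norm y *: x^T - l2norm x *: y^T.
  by rewrite linearB/= !linearZ.
rewrite mulmxBl !mulmxBr -!scalemxAl -!scalemxAr.
have -> : y^T *m x = (x^T *m y)^T by rewrite trmx_mul trmxK.
move: (sqr_l2norm x) (sqr_l2norm y).
move: (x^T *m x) (y^T *m y) (x^T *m y) => p q r px qy; rewrite !mxE -px -qy.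
set u := l2norm x in xy0 *; set v := l2norm y in xy0 *; move=> h.
have : 0 <= (u * v) * (u * v - r 0 0) by nra.
by rewrite pmulr_rge0// subr_ge0.
Qed.

End spectral.

(** * The weighted sum [M] of row projections: trace and quadratic form on the cone *)

Section rescaling.
Context {R : realType} {m n : nat} (A : 'M[R]_(m, n)) (lambda : 'cV[R]_m).
Context (A1 : forall i, l2norm (row_vec A i) = 1).
Context (lambda_ge0 : forall i, 0 <= lambda i 0).
Let M := \sum_i lambda i 0 *: (row_vec A i *m (row_vec A i)^T).

Lemma row_vec_dot (x : 'cV[R]_n) i : ((row_vec A i)^T *m x) 0 0 = (A *m x) i 0.
Proof. by rewrite trmxK -row_mul mxE. Qed.

Lemma weighted_gram_quad (x : 'cV[R]_n) :
  (x^T *m M *m x) 0 0 = \sum_i lambda i 0 * (A *m x) i 0 ^+ 2.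
Proof.
rewrite mulmx_sumr mulmx_suml summxE; apply: eq_bigr => i _.
rewrite -scalemxAr -scalemxAl [LHS]mxE -row_vec_dot; congr (_ * _).
set v := row_vec A i.
have -> : x^T *m (v *m v^T) *m x = (v^T *m x)^T *m (v^T *m x).
  by rewrite trmx_mul trmxK !mulmxA.
by rewrite -sqr_l2norm /l2norm big_ord1 sqrtr_sqr real_normK ?num_real.
Qed.

Lemma weighted_gram_psd : psdmx M.
Proof.
split=> [|x].
  rewrite linear_sum; apply: eq_bigr => i _.
  by rewrite linearZ/= trmx_mul trmxK.
by rewrite weighted_gram_quad sumr_ge0// => i _; rewrite mulr_ge0// sqr_ge0.
Qed.

Lemma weighted_gram_trace : \tr M = \sum_i lambda i 0.
Proof.
rewrite linear_sum/=; apply: eq_bigr => i _.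
by rewrite linearZ/= mxtrace_mulC trace_mx11 -sqr_l2norm A1 expr1n mulr1.
Qed.

Lemma weighted_gram_quad_cone (x : 'cV[R]_n) : (forall i, 0 < (A *m x) i 0) ->
  (x^T *m M *m x) 0 0 <= l2norm (\sum_i lambda i 0 *: row_vec A i) * l2norm x ^+ 2.
Proof.
move=> Ax; set y := \sum_i _ *: _.
(* In each square one factor is bounded by [|x|] while the other, positive on the cone, is kept;
   what remains is linear in [lambda]. *)
apply: (@le_trans _ _ (l2norm x * (y^T *m x) 0 0)); last first.
  rewrite mulrC expr2 mulrA ler_wpM2r ?l2norm_ge0//; exact: dotmx_le_l2norm.
rewrite weighted_gram_quad /y linear_sum/= mulmx_suml summxE mulr_sumr.
apply: ler_sum => i _; rewrite linearZ/= -scalemxAl [X in _ <= _ * X]mxE row_vec_dot.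
rewrite [leRHS]mulrCA ler_wpM2l// expr2 ler_wpM2r//; first exact: ltW.
by rewrite -row_vec_dot; apply: le_trans (dotmx_le_l2norm _ _) _; rewrite A1 mul1r.
Qed.

End rescaling.

Theorem lemma8 (R : realType) (m n : nat) (A : 'M[R]_(m, n))
    (lambda : 'cV[R]_m) (alpha : R) :
  (forall i, l2norm (row_vec A i) = 1) ->
  (forall i, 0 <= lambda i 0) ->
  l1norm lambda = 1 ->
  l2norm (\sum_i lambda i 0 *: row_vec A i) <= 1 / (10 * n%:R) ->
  let P := [set x : 'cV[R]_n | forall i, 0 < (A *m x) i 0] in
  let B := @unit_ball R n in
  let M := \sum_i lambda i 0 *: (row_vec A i *m (row_vec A i)^T) in
  let delta_max := max_eigenvalue M in
  0 <= alpha <= 1 / delta_max ->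
  let F := fun x : 'cV[R]_n => sqrtmx (1%:M + alpha *: M) *m x in
  ((expR (alpha / 5))%:E * vol (P `&` B) <= vol ((F @` P) `&` B))%E.
Proof.
move=> A1 lambda_ge0 lambda1 lambdaA P B M delta_max /andP[alpha0 alpha_le].
set F := (F in let F := F in _); rewrite -[let F := _ in _]/(_ <= _)%E.
have psdM : psdmx M by exact: weighted_gram_psd.
have sum_lambda : \sum_i lambda i 0 = 1.
  by rewrite -lambda1; apply: eq_bigr => i _; rewrite ger0_norm.
(* In dimension 0 every row would have norm 0 instead of 1, so there would be no rows and [lambda]
   could not sum to 1. *)
have n0 : (0 < n)%N.
  rewrite lt0n; apply: contra_eq_neq sum_lambda => n0.
  rewrite big1 ?[_ == 1]eq_sym ?oner_neq0// => i _.
  have : row_vec A i = 0.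
    by apply/colP => j; have /lt0n_neq0/eqP[] := leq_ltn_trans (leq0n j) (ltn_ord j).
  by move/eqP; rewrite -l2norm_eq0 A1 oner_eq0.
have psdaM : psdmx (alpha *: M).
  split=> [|x]; first by rewrite linearZ/= psdM.1.
  by rewrite -scalemxAr -scalemxAl mxE mulr_ge0// psdM.2.
have psdN : psdmx (1%:M + alpha *: M).
  split=> [|x]; first by rewrite linearD/= trmx1 psdaM.1.
  by rewrite mulmxDr mulmx1 mulmxDl mxE -sqr_l2norm addr_ge0 ?sqr_ge0// psdaM.2.
have [[Ssym _] SS] := sqrtmxP psdN.
set S := sqrtmx _ in Ssym SS F *.
have detN : expR (alpha / 2) <= \det (1%:M + alpha *: M).
  have {1}-> : alpha = \tr (alpha *: M).
    by rewrite linearZ/= weighted_gram_trace// sum_lambda mulr1.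
  apply: expR_mxtrace_le_det => // a.
  move=> /eigenvalueP[v va v0].
  have [alpha_eq0|alpha_neq0] := eqVneq alpha 0.
    have /esym/eqP : 0 = a *: v by rewrite -va alpha_eq0 scale0r mulmx0.
    by rewrite scaler_eq0 (negPf v0) orbF => /eqP ->.
  have aM : a / alpha <= delta_max.
    apply: psdmx_eigenvalue_le => //; apply/eigenvalueP; exists v => //.
    by rewrite mulrC -scalerA -va -scalemxAr scalerA mulVf// scale1r.
  have alpha_gt0 : 0 < alpha by rewrite lt_def alpha_neq0.
  move: aM; rewrite ler_pdivrMr// => /le_trans; apply.
  (* Cross-multiplying [alpha <= 1 / delta_max] requires [delta_max > 0]; otherwise
     [delta_max * alpha <= 0] already suffices. *)
  have [delta0|delta0] := ltP 0 delta_max; first by rewrite mulrC -ler_pdivlMr.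
  by apply: (@le_trans _ _ 0); rewrite ?ler01// mulr_le0_ge0.
pose c := 1 + alpha / (10 * n%:R).
have c1 : 1 <= c by rewrite lerDl divr_ge0// mulr_ge0.
have c0 : 0 < c by exact: lt_le_trans c1.
pose G := (Num.sqrt c)^-1 *: S.
have detG2 : \det G ^+ 2 = (c ^+ n)^-1 * \det (1%:M + alpha *: M).
  rewrite -SS det_mulmx detZ exprMn -[in RHS]expr2 exprAC exprVn.
  by rewrite sqr_sqrtr ?(ltW c0)// exprVn.
have detG : expR (alpha / 5) <= `|\det G|.
  rewrite -(@ler_pXn2r _ 2) ?nnegrE ?expR_ge0// real_normK ?num_real// detG2.
  rewrite ler_pdivlMl ?exprn_gt0//; apply: le_trans detN.
  (* [c ^ n <= exp(alpha/10)] follows from [1 + t <= exp t], and the exponents balance exactly: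
     [alpha/10 + 2 * (alpha/5) = alpha/2]. *)
  rewrite -expRM_natl; apply: (@le_trans _ _ (expR (alpha / 10) * expR (2%:R * (alpha / 5)))).
    rewrite ler_wpM2r ?expR_ge0//.
    rewrite (_ : alpha / 10 = n%:R * (alpha / (10 * n%:R))).
      by rewrite expRM_natl lerXn2r ?nnegrE ?expR_ge0 ?(ltW c0)// expR_ge1Dx.
    by field; rewrite pnatr_eq0 -lt0n.
  rewrite -expRD ler_expR; lra.
have Gu : G \in unitmx.
  by rewrite unitmxE unitfE -normr_gt0 (lt_le_trans _ detG)// expR_gt0.
(* The cone is stable under positive scaling, and [|G x|^2 = x^T N x / c], at most 1 by the choice
   of [c]. *)
have GPB x : (P `&` B) x -> (F @` P `&` B) (G *m x).
  move=> [Px Bx]; split.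
    exists ((Num.sqrt c)^-1 *: x); last by rewrite /F -scalemxAr scalemxAl.
    by move=> i; rewrite -scalemxAr mxE mulr_gt0// invr_gt0 sqrtr_gt0.
  rewrite /B/unit_ball/= -(@ler_pXn2r _ 2) ?nnegrE ?l2norm_ge0// expr1n.
  rewrite -scalemxAl l2normZ exprMn real_normK ?num_real// exprVn sqr_sqrtr ?(ltW c0)//.
  rewrite ler_pdivrMl// mulr1 sqr_l2norm trmx_mul Ssym mulmxA -(mulmxA _ S S) SS.
  rewrite mulmxDr mulmx1 mulmxDl mxE -sqr_l2norm -scalemxAr -scalemxAl mxE.
  have x1 : l2norm x ^+ 2 <= 1 by rewrite expr_le1// l2norm_ge0.
  rewrite lerD// ler_wpM2l//.
  apply: le_trans (weighted_gram_quad_cone A1 lambda_ge0 Px) _.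
  rewrite -[leRHS]mulr1 ler_pM ?l2norm_ge0 ?sqr_ge0//.
  by rewrite -div1r.
(* The volume bound is applied to the inverse of [G], which maps [F(P) /\ B] onto a set containing
   [P /\ B]. *)
have := vol_image_le_unitmx (etrans (unitmx_inv _) Gu) (F @` P `&` B).
rewrite det_inv normfV lee_pdivlMl ?normr_gt0 -?unitfE -?unitmxE//; apply: le_trans.
apply: lee_pmul; rewrite ?lee_fin ?expR_ge0 ?vol_ge0//.
apply: vol_subset => x /GPB GPBx; exists (G *m x) => //.
by rewrite mulKmx.
Qed.
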